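(* Let $\gamma(t)=(\mathbf n_t,c_t\boldsymbol\epsilon)$, $0\le t\le1$, be a Lorentzian geodesic in $\mathcal T^n$, defining the family of hyperplanes $\Pi_t=\{\mathbf x\in\mathbb R^n:\mathbf n_t\cdot\mathbf x=c_t\}$. If $\{e_{i,0}:1\le i\le n-1\}$ is an orthonormal frame for $\Pi_0$, then there is a smoothly varying family of orthonormal frames $\{e_{i,t}:1\le i\le n-1\}$ for $\Pi_t$, beginning with $\{e_{i,0}\}$ at $t=0$, and smooth functions $\beta_i(t)$, such that the vector fields $\tilde e_{i,t}=(e_{i,t},\beta_i(t)\boldsymbol\epsilon)$, $1\le i\le n-1$, along $\gamma$ form a family of Lorentzian parallel vector fields on $\mathcal T^n$ which are Lorentzian orthonormal.
   Context: $\Lambda^{n+1}=\{v\in\mathbb R^{n+2}:\langle v,v\rangle_L=1\}$, with $\langle v,w\rangle_L=\sum_{i=1}^{n+1}v_iw_i-v_{n+2}w_{n+2}$ and the induced Lorentzian metric. $\boldsymbol\epsilon=(1,1)$; $\mathcal T^n=\{(\mathbf n,c\boldsymbol\epsilon)=(\mathbf n,c,c):\mathbf n\in S^{n-1},c\in\mathbb R\}\subset\Lambda^{n+1}$. A Lorentzian geodesic in $\mathcal T^n$ is a geodesic of $\Lambda^{n+1}$ lying in $\mathcal T^n$; those joining $z_0=(\mathbf n_0,c_0\boldsymbol\epsilon)$ to $z_1=(\mathbf n_1,c_1\boldsymbol\epsilon)$, $\mathbf n_1\ne-\mathbf n_0$, considered in the paper are $\gamma(t)=\lambda(t,\theta)z_1+\lambda(1-t,\theta)z_0$,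 with $\theta\in[0,\pi)$, $\cos\theta=\mathbf n_0\cdot\mathbf n_1$, $\lambda(x,\theta)=\sin(x\theta)/\sin\theta$ for $\theta\neq0$, $\lambda(x,0)=x$. An orthonormal frame for $\Pi_t$ is an orthonormal basis of the linear hyperplane $\mathbf n_t^\perp$. A vector field $(\zeta(t),\beta(t)\boldsymbol\epsilon)$ along $\gamma$ with $\zeta(t)\cdot\mathbf n_t=0$ is tangent to $\mathcal T^n$; it is a Lorentzian parallel vector field on $\mathcal T^n$ if it is parallel along $\gamma$ for the Levi-Civita connection of $\Lambda^{n+1}$. Lorentzian orthonormal means orthonormal for $\langle\cdot,\cdot\rangle_L$ at each $t$. *)

(* Defs.v *)
From HB Require Import structures.
From mathcomp Require Import all_boot all_order all_algebra.
From mathcomp Require Import all_classical all_reals all_analysis.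

Set Implicit Arguments.
Unset Strict Implicit.
Unset Printing Implicit Defensive.

Import Order.TTheory GRing.Theory Num.Theory.
Import numFieldNormedType.Exports.

Local Open Scope classical_set_scope.
Local Open Scope ring_scope.

Section Minkowski.
Context {R : realType}.

Definition dot {n} (u v : 'rV[R]_n) : R := \sum_(i < n) u 0 i * v 0 i.

(* R^(n+2) is 'rV[R]_(n + 1 + 1), so that the last (timelike) coordinate of v
   is rsubmx v and the n+1 spacelike ones are lsubmx v. *)
Definition lform {n} (v w : 'rV[R]_(n + 1 + 1)) : R :=
  dot (lsubmx v) (lsubmx w) - dot (rsubmx v) (rsubmx w).

Definition Lambda n : set 'rV[R]_(n + 1 + 1) := [set v | lform v v = 1].

(* (u, c * epsilon) = (u, c, c); used both for points and for tangent vectors. *)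
Definition eps_pair {n} (u : 'rV[R]_n) (c : R) : 'rV[R]_(n + 1 + 1) :=
  row_mx (row_mx u (const_mx c)) (const_mx c).

Definition Tset n : set 'rV[R]_(n + 1 + 1) :=
  [set z | exists u c, dot u u = 1 /\ z = eps_pair u c].

(* C^oo on a set that need not be open (here [0, 1]): f is C^oo on an open
   neighbourhood of A, so that at the points of A the two-sided derivatives of
   f are the derivatives of f along A. *)
Definition smooth_on {V : normedModType R} (A : set R) (f : R -> V) : Prop :=
  exists U : set R, [/\ open U, A `<=` U &
    forall k t, U t -> derivable (derive1n k f) t 1].

(* Levi-Civita covariant derivative of Lambda along gamma: the component
   tangent to Lambda of the derivative in the flat ambient space.  The tangent
   space at p is the lform-orthogonal of p and lform p p = 1, so the normal
   component of w at p is lform w p *: p.  See covder_tangent, covder_metric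
   and covder_symmetric for the characteristic properties. *)
Definition covder {n} (gamma X : R -> 'rV[R]_(n + 1 + 1)) (t : R) :
    'rV[R]_(n + 1 + 1) :=
  derive1 X t - lform (derive1 X t) (gamma t) *: gamma t.

Definition geodesic {n} (gamma : R -> 'rV[R]_(n + 1 + 1)) : Prop :=
  [/\ smooth_on `[0, 1] gamma,
      forall t, t \in `[0, 1] -> Lambda (gamma t) &
      forall t, t \in `[0, 1] -> covder gamma (derive1 gamma) t = 0].

Definition lorentzian_geodesic {n} (gamma : R -> 'rV[R]_(n + 1 + 1)) : Prop :=
  geodesic gamma /\ forall t, t \in `[0, 1] -> Tset (gamma t).

Definition parallel_along {n} (gamma X : R -> 'rV[R]_(n + 1 + 1)) : Prop :=
  [/\ smooth_on `[0, 1] X,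
      forall t, t \in `[0, 1] -> lform (X t) (gamma t) = 0 &
      forall t, t \in `[0, 1] -> covder gamma X t = 0].

(* The field (zeta t, beta t * epsilon) along the curve (nu t, c t * epsilon)
   is tangent to Tset n and parallel for the connection of Lambda. *)
Definition lorentzian_parallel {n} (nu : R -> 'rV[R]_n) (c : R -> R)
    (zeta : R -> 'rV[R]_n) (beta : R -> R) : Prop :=
  (forall t, t \in `[0, 1] -> dot (zeta t) (nu t) = 0) /\
  parallel_along (fun t => eps_pair (nu t) (c t))
                 (fun t => eps_pair (zeta t) (beta t)).

(* Orthonormal basis of the linear hyperplane orthogonal to u, i.e.
   orthonormal frame for every affine hyperplane {x | dot u x = c}. *)
Definition orthonormal_frame {n} (u : 'rV[R]_n) (e : 'I_n.-1 -> 'rV[R]_n) :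
    Prop :=
  (forall i j, dot (e i) (e j) = (i == j)%:R) /\
  (forall x, dot u x = 0 <-> exists a : 'I_n.-1 -> R, x = \sum_i a i *: e i).

Lemma dotC n (u v : 'rV[R]_n) : dot u v = dot v u.
Proof. by apply: eq_bigr => i _; rewrite mulrC. Qed.

Lemma dotDl n (u v w : 'rV[R]_n) : dot (u + v) w = dot u w + dot v w.
Proof. by rewrite -big_split; apply: eq_bigr => i _; rewrite mxE mulrDl. Qed.

Lemma dotZl n a (u w : 'rV[R]_n) : dot (a *: u) w = a * dot u w.
Proof. by rewrite mulr_sumr; apply: eq_bigr => i _; rewrite mxE mulrA. Qed.

Lemma lformC n (v w : 'rV[R]_(n + 1 + 1)) : lform v w = lform w v.
Proof. by rewrite /lform dotC [in X in _ - X]dotC. Qed.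

Lemma lformDl n (u v w : 'rV[R]_(n + 1 + 1)) :
  lform (u + v) w = lform u w + lform v w.
Proof. by rewrite /lform !linearD /= !dotDl opprD addrACA. Qed.

Lemma lformZl n a (u w : 'rV[R]_(n + 1 + 1)) : lform (a *: u) w = a * lform u w.
Proof. by rewrite /lform !linearZ /= !dotZl mulrBr. Qed.

Lemma lformBl n (u v w : 'rV[R]_(n + 1 + 1)) :
  lform (u - v) w = lform u w - lform v w.
Proof. by rewrite -scaleN1r lformDl lformZl mulN1r. Qed.

Lemma lform_eps_pair n (u v : 'rV[R]_n) (a b : R) :
  lform (eps_pair u a) (eps_pair v b) = dot u v.
Proof.
rewrite /lform /dot /eps_pair !row_mxKl !row_mxKr big_split_ord /=.
under eq_bigr do rewrite !row_mxEl.
by rewrite !big_ord1 !row_mxEr !mxE addrK.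
Qed.

Lemma Tset_sub n : @Tset n `<=` @Lambda n.
Proof. by move=> _ [u [c [u1 ->]]]; rewrite /Lambda /= lform_eps_pair. Qed.

Lemma covder_tangent n (gamma X : R -> 'rV[R]_(n + 1 + 1)) t :
  Lambda (gamma t) -> lform (covder gamma X t) (gamma t) = 0.
Proof. by move=> g1; rewrite lformBl lformZl g1 mulr1 subrr. Qed.

Lemma derive1_lform n (X Y : R -> 'rV[R]_(n + 1 + 1)) t :
  derivable X t 1 -> derivable Y t 1 ->
  derive1 (fun s => lform (X s) (Y s)) t =
    lform (derive1 X t) (Y t) + lform (X t) (derive1 Y t).
Proof.
move=> dX dY; rewrite !derive1E (derive_mx dX) (derive_mx dY).
have dXi i : derivable (fun s => X s 0 i) t 1 by move/derivable_mxP : dX; exact.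
have dYi i : derivable (fun s => Y s 0 i) t 1 by move/derivable_mxP : dY; exact.
have E (Z W : 'rV[R]_(n + 1 + 1)) : lform Z W =
  \sum_(i < n + 1) Z 0 (lshift 1 i) * W 0 (lshift 1 i)
  - \sum_(i < 1) Z 0 (rshift (n + 1) i) * W 0 (rshift (n + 1) i).
  by rewrite /lform /dot; congr (_ - _); apply: eq_bigr => i _; rewrite !mxE.
have -> : (fun s => lform (X s) (Y s)) =
  (\sum_(i < n + 1)
     (fun s => X s 0 (lshift 1 i)) * (fun s => Y s 0 (lshift 1 i)))
  - \sum_(i < 1)
     (fun s => X s 0 (rshift (n + 1) i)) * (fun s => Y s 0 (rshift (n + 1) i)).
  by apply/funext => s; rewrite E !fctE !fct_sumE.
rewrite deriveB; last 2 first.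
- by apply: derivable_sum => i; exact: derivableM.
- by apply: derivable_sum => i; exact: derivableM.
rewrite !derive_sum; try by move=> i; exact: derivableM.
rewrite !E addrACA -opprD -!big_split /=.
have key i : 'D_1 ((fun s => X s 0 i) * (fun s => Y s 0 i)) t =
    (\matrix_(i0, j) 'D_1 (fun s => X s i0 j) t) 0 i * Y t 0 i +
    X t 0 i * (\matrix_(i0, j) 'D_1 (fun s => Y s i0 j) t) 0 i.
  by rewrite (deriveM (dXi i) (dYi i)) !mxE addrC -[_ *: _]/(_ * _) mulrC.
by congr (_ - _); apply: eq_bigr => i _; exact: key.
Qed.

Lemma covder_metric n (gamma X Y : R -> 'rV[R]_(n + 1 + 1)) t :
  derivable X t 1 -> derivable Y t 1 ->
  lform (X t) (gamma t) = 0 -> lform (Y t) (gamma t) = 0 ->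
  derive1 (fun s => lform (X s) (Y s)) t =
    lform (covder gamma X t) (Y t) + lform (X t) (covder gamma Y t).
Proof.
move=> dX dY X0 Y0.
have E (Z : R -> 'rV[R]_(n + 1 + 1)) W : lform W (gamma t) = 0 ->
    lform (covder gamma Z t) W = lform (derive1 Z t) W.
  move=> W0; rewrite /covder lformBl lformZl (lformC (gamma t)) W0.
  by rewrite mulr0 subr0.
by rewrite (derive1_lform dX dY) (E X _ Y0) (lformC (X t) (covder gamma Y t))
  (E Y _ X0) (lformC (X t)).
Qed.

(* Torsion-freeness, for a two-parameter map sigma into Lambda. *)
Lemma covder_symmetric n (sigma : R -> R -> 'rV[R]_(n + 1 + 1)) s t :
  derive1 (fun s' => derive1 (sigma s') t) s =
    derive1 (fun t' => derive1 (sigma^~ t') s) t ->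
  covder (sigma^~ t) (fun s' => derive1 (sigma s') t) s =
  covder (sigma s) (fun t' => derive1 (sigma^~ t') s) t.
Proof. by move=> E; rewrite /covder E. Qed.

End Minkowski.

(* Main.v *)
Require Import Defs.
From HB Require Import structures.
From mathcomp Require Import all_boot all_order all_algebra.
From mathcomp Require Import all_classical all_reals all_analysis.
From mathcomp Require Import ring.

Set Implicit Arguments.
Unset Strict Implicit.
Unset Printing Implicit Defensive.

Import Order.TTheory GRing.Theory Num.Theory.
Import numFieldNormedType.Exports.

Local Open Scope classical_set_scope.
Local Open Scope ring_scope.

(** The Lorentzian form of two vectors (u, a eps), (v, b eps) is u . v, so the
geodesic equation reads nu'' = - k nu, c'' = - k c with k = |nu'|^2 constant, and
a field (e, beta eps) is parallel iff e' = - (e . nu') nu, beta' = - (e . nu') c.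
As e . nu' is then a constant a, the solution is e = e_0 - a int nu, and
nu'' = - k nu integrates nu: e = e_0 + (a / k) (nu' - nu'(0)), likewise
beta = (a / k) (c' - c'(0)).  So the field is a constant vector plus (a / k)
times the velocity, and it is parallel because the velocity has zero covariant
derivative.  Its tangency e . nu = 0 follows from uniqueness for the harmonic
system satisfied by g = e . nu and h = e . nu', namely g' = h - a, h' = - k g;
scalar products are preserved because e_i' is a multiple of nu. *)

(** * Scalar products, orthonormal frames and derivatives of row-vector curves *)

Section RowVectors.
Context {R : realType}.

Lemma dot0r n (u : 'rV[R]_n) : dot u 0 = 0.
Proof. by rewrite /dot big1 // => i _; rewrite mxE mulr0. Qed.

Lemma dotDr n (u v w : 'rV[R]_n) : dot u (v + w) = dot u v + dot u w.
Proof. by rewrite dotC dotDl !(dotC u). Qed.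

Lemma dotZr n a (u v : 'rV[R]_n) : dot u (a *: v) = a * dot u v.
Proof. by rewrite dotC dotZl dotC. Qed.

Lemma dot_eq0 n (u : 'rV[R]_n) : dot u u = 0 -> u = 0.
Proof.
move=> u0; apply/rowP => i; rewrite mxE; apply/eqP.
have /eqP := u0; rewrite psumr_eq0 => [/allP/(_ i (mem_index_enum i))|j _].
  by rewrite mulf_eq0 orbb.
by rewrite -expr2 sqr_ge0.
Qed.

Lemma dot_sumr n m (u : 'rV[R]_n) (a : 'I_m -> R) (e : 'I_m -> 'rV[R]_n) :
  dot u (\sum_i a i *: e i) = \sum_i a i * dot u (e i).
Proof.
elim/big_rec2: _ => [|i x y _ <-]; last by rewrite dotDr dotZr.
exact: dot0r.
Qed.

Lemma eps_pairZ n a (u : 'rV[R]_n) b :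
  eps_pair (a *: u) (a * b) = a *: eps_pair u b.
Proof. by rewrite /eps_pair !scale_row_mx !scalemx_const. Qed.

Lemma eps_pair_inj n (u v : 'rV[R]_n) a b :
  eps_pair u a = eps_pair v b -> u = v.
Proof. by move=> /eq_row_mx[/eq_row_mx[]]. Qed.

(** The rows [u], [e i] form a square matrix [M] with [M *m M^T = 1], hence also [M^T *m M = 1]. So
    [x = x *m M^T *m M] expands [x] along these rows, and its coefficient along [u] is
    [dot x u = 0]. Transport thus only has to preserve tangency and scalar products; spanning
    follows. *)
Lemma orthonormal_span n (u : 'rV[R]_n) (e : 'I_n.-1 -> 'rV[R]_n) :
  dot u u = 1 -> (forall i, dot u (e i) = 0) ->
  (forall i j, dot (e i) (e j) = (i == j)%:R) ->
  orthonormal_frame u e.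
Proof.
case: n u e => [|n] u e u1 ue ee.
  (* There is no unit vector in dimension 0; otherwise [u] and the [n.-1] vectors [e i] are exactly
     [n] rows. *)
  by move: u1; rewrite /dot big_ord0 => /esym/eqP; rewrite oner_eq0.
split=> // x; split=> [ux|[a ->]]; last first.
  by rewrite dot_sumr big1 // => i _; rewrite ue mulr0.
pose f i := oapp e u (unlift ord0 i).
pose M := \matrix_i f i.
have MM : M *m M^T = 1%:M.
  apply/matrixP => i j; rewrite [RHS]mxE [LHS]mxE.
  transitivity (dot (f i) (f j)); first by apply: eq_bigr => k _; rewrite !mxE.
  rewrite /f; case: unliftP => [i'|] -> /=; case: unliftP => [j'|] -> //=.
  by rewrite dotC ue.
exists (fun i => (x *m M^T) 0 (lift ord0 i)).
rewrite -{1}[x]mulmx1 -(mulmx1C MM) mulmxA mulmx_sum_row big_ord_recl.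
have -> : (x *m M^T) 0 ord0 = 0.
  rewrite mxE -[RHS]ux dotC; apply: eq_bigr => k _.
  by rewrite !mxE /f unlift_none.
rewrite scale0r add0r; apply: eq_bigr => i _.
by rewrite rowK /f liftK.
Qed.

Lemma is_derive_mxP m n (M : R -> 'M[R]_(m, n)) (t : R) (dM : 'M[R]_(m, n)) :
  is_derive t (1 : R) M dM <->
  forall i j, is_derive t (1 : R) (fun s => M s i j) (dM i j).
Proof.
split=> [[d dE] i j|H].
  apply: DeriveDef; first by move/derivable_mxP : d; exact.
  by rewrite -dE (derive_mx d) mxE.
have d : derivable M t 1 by apply/derivable_mxP => i j; case: (H i j).
apply: DeriveDef => //; rewrite (derive_mx d); apply/matrixP => i j.
by rewrite mxE; case: (H i j).
Qed.

Lemma is_derive_dot n (u v : R -> 'rV[R]_n) t du dv :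
  is_derive t (1 : R) u du -> is_derive t (1 : R) v dv ->
  is_derive t (1 : R) (fun s => dot (u s) (v s)) (dot du (v t) + dot (u t) dv).
Proof.
move=> /is_derive_mxP du' /is_derive_mxP dv'.
have -> : (fun s => dot (u s) (v s)) =
    \sum_(i < n) (fun s => u s 0 i) * (fun s => v s 0 i).
  by apply/funext => s; rewrite fct_sumE.
have H i := is_deriveM (du' 0 i) (dv' 0 i).
apply: (is_derive_eq (is_derive_sum H)); rewrite /dot -big_split.
by apply: eq_bigr => i _ /=; rewrite addrC (mulrC (du 0 i)).
Qed.

Lemma is_derive_eps_pair n (u : R -> 'rV[R]_n) (c : R -> R) t du dc :
  is_derive t (1 : R) u du -> is_derive t (1 : R) c dc ->
  is_derive t (1 : R) (fun s => eps_pair (u s) (c s)) (eps_pair du dc).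
Proof.
move=> /is_derive_mxP du' dc'; apply/is_derive_mxP => i j.
case: (split_ordP j) => [k|k] ->; last first.
  under eq_fun do rewrite row_mxEr mxE.
  by rewrite row_mxEr mxE.
case: (split_ordP k) => [l|l] ->.
  under eq_fun do rewrite !row_mxEl.
  by rewrite !row_mxEl.
under eq_fun do rewrite row_mxEl row_mxEr mxE.
by rewrite row_mxEl row_mxEr mxE.
Qed.

Lemma derivable_eps_pair n (u : R -> 'rV[R]_n) (c : R -> R) t :
  derivable (fun s => eps_pair (u s) (c s)) t 1 ->
  derivable u t 1 /\ derivable c t 1.
Proof.
move=> /derivable_mxP d; split.
  apply/derivable_mxP => i j; have := d i (lshift 1 (lshift 1 j)).
  by under eq_fun do rewrite !row_mxEl.
have := d 0 (rshift (n + 1) 0).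
by under eq_fun do rewrite row_mxEr mxE.
Qed.

Lemma derive1_eps_pair n (u : R -> 'rV[R]_n) (c : R -> R) t :
  derivable u t 1 -> derivable c t 1 ->
  derive1 (fun s => eps_pair (u s) (c s)) t =
    eps_pair (derive1 u t) (derive1 c t).
Proof.
move=> du dc; rewrite !derive1E.
by have [] := is_derive_eps_pair (derivableP du) (derivableP dc).
Qed.

End RowVectors.

(** * Smoothness on a set, and differential identities on the unit interval *)

Section Smoothness.
Context {R : realType}.

(** Formulas for iterated derivatives are known only on an open neighbourhood; this locality is what
    allows differentiating them once more. *)
Lemma open_eq_near {T : topologicalType} {V : Type} (U : set T) (f g : T -> V) t :
  open U -> U t -> (forall s, U s -> f s = g s) -> \near t, f t = g t.
Proof.
move=> oU Ut fg; near=> s; apply: fg.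
by near: s; exact: open_nbhs_nbhs.
Unshelve. all: by end_near. Qed.

Lemma open_eq_derive1 {V : normedModType R} (U : set R) (f g : R -> V) t :
  open U -> U t -> (forall s, U s -> f s = g s) -> derive1 f t = derive1 g t.
Proof.
by move=> oU Ut fg; rewrite !derive1E; apply: near_eq_derive; exact: open_eq_near fg.
Qed.

Lemma open_eq_derivable {V : normedModType R} (U : set R) (f g : R -> V) t :
  open U -> U t -> (forall s, U s -> f s = g s) ->
  derivable f t 1 -> derivable g t 1.
Proof.
by move=> oU Ut fg; apply: near_eq_derivable; exact: open_eq_near fg.
Qed.

Lemma smooth_on_eps_pair n (A : set R) (u : R -> 'rV[R]_n) (c : R -> R) :
  smooth_on A (fun t => eps_pair (u t) (c t)) <->
  smooth_on A u /\ smooth_on A c.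
Proof.
split=> [[U [oU AU sU]]|[[U [oU AU sU]] [W [oW AW sW]]]].
  (* Derivability of both components is carried through the induction, since the derivative of the
     pair is split only once it is known. *)
  have H k : forall t, U t -> derive1n k (fun t => eps_pair (u t) (c t)) t =
      eps_pair (derive1n k u t) (derive1n k c t) /\
      (derivable (derive1n k u) t 1 /\ derivable (derive1n k c) t 1).
    elim: k => [|k IH] t Ut.
      by split=> //; apply: derivable_eps_pair; exact: (sU 0%N).
    have E s : U s -> derive1n k.+1 (fun t => eps_pair (u t) (c t)) s =
        eps_pair (derive1n k.+1 u s) (derive1n k.+1 c s).
      move=> Us; have [_ [du dc]] := IH _ Us.
      rewrite -derive1_eps_pair //; apply: (open_eq_derive1 oU) => // r Ur.
      by have [] := IH _ Ur.
    split; first exact: E.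
    apply: derivable_eps_pair; apply: (open_eq_derivable oU Ut E).
    exact: (sU k.+1).
  by split; exists U; split=> // k t Ut; have [_ []] := H k t Ut.
have oUW : open (U `&` W) by exact: openI.
exists (U `&` W); split=> // [t At|]; first by split; [exact: AU|exact: AW].
have D k t : (U `&` W) t -> derivable (fun t =>
    eps_pair (derive1n k u t) (derive1n k c t)) t 1.
  move=> [Ut Wt].
  by case: (is_derive_eps_pair (derivableP (sU k t Ut)) (derivableP (sW k t Wt))).
have E k t : (U `&` W) t -> derive1n k (fun t => eps_pair (u t) (c t)) t =
      eps_pair (derive1n k u t) (derive1n k c t).
  elim: k t => [//|k IH] t [Ut Wt].
  rewrite !derive1nS -derive1_eps_pair; [|exact: sU|exact: sW].
  by apply: (open_eq_derive1 oUW).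
move=> k t UWt; apply: (open_eq_derivable oUW UWt _ (D k t UWt)).
by move=> s UWs; rewrite E.
Qed.

Lemma is_derive_affine {V : normedModType R} (v df : V) q (f : R -> V) t :
  is_derive t (1 : R) f df -> is_derive t (1 : R) (fun s => v + q *: f s) (q *: df).
Proof.
move=> d; have := is_deriveD (is_derive_cst v t 1) (is_deriveZ q d).
by move/is_derive_eq; apply; rewrite add0r.
Qed.

(** The derivative of order [k] is [q] times that of [f] of order [k.+1], plus [v] when [k = 0].
    Both components of the parallel fields have this form. *)
Lemma smooth_on_affine_derive1 {V : normedModType R} (A : set R) (f : R -> V) v q :
  smooth_on A f -> smooth_on A (fun t => v + q *: derive1 f t).
Proof.
move=> [U [oU AU sU]]; exists U; split=> //.
have D k t v' : U t -> is_derive t (1 : R) (fun t => v' + q *: derive1n k f t)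
    (q *: derive1n k.+1 f t).
  by move=> Ut; rewrite derive1nS derive1E; exact/is_derive_affine/derivableP/sU.
have E k t : U t -> derive1n k (fun t => v + q *: derive1 f t) t =
    (if k is 0%N then v else 0) + q *: derive1n k.+1 f t.
  elim: k t => [//|k IH] t Ut; rewrite derive1nS (open_eq_derive1 oU Ut IH).
  by rewrite derive1E add0r; have [_ ->] := D k.+1 t (if k is 0%N then v else 0) Ut.
move=> k t Ut; apply: (open_eq_derivable oU Ut) => [s Us|].
  exact/esym/E.
by have [] := D k.+1 t (if k is 0%N then v else 0) Ut.
Qed.

(* The derivative is only required to vanish in the interior, because that is
   where an identity valid on [0, 1] may be differentiated. *)
Lemma eq_on_unit_interval (f df : R -> R) :
  (forall t : R, t \in `[0, 1] -> is_derive t (1 : R) f (df t)) ->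
  (forall t : R, t \in `]0, 1[ -> df t = 0) ->
  forall t : R, t \in `[0, 1] -> f t = f 0.
Proof.
move=> f_deriv df0 t; rewrite in_itv /= => /andP[t0 t1].
have sub s : s \in `[0, t]%R -> s \in `[0, 1].
  rewrite !in_itv /= => /andP[-> st]; exact: le_trans st t1.
move: t0; rewrite le_eqVlt => /predU1P[<-//|t0].
have f_deriv' s : s \in `]0, t[%R -> is_derive s (1 : R) f (df s).
  by move=> st; apply/f_deriv/sub; exact: subset_itv_oo_cc st.
have f_cont : {within `[0, t], continuous f}.
  by apply: derivable_within_continuous => s /sub s01; have [] := f_deriv s s01.
have [s] := MVT t0 f_deriv' f_cont.
rewrite in_itv /= => /andP[s0 st] /eqP.
rewrite df0 ?mul0r ?subr_eq0 => [/eqP//|].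
by rewrite in_itv /= s0 (lt_le_trans st).
Qed.

(** The open interval is a neighbourhood of [t]; at an endpoint the two-sided derivative would also
    depend on values outside [[0, 1]]. *)
Lemma derive_cst_on_unit_interval (f : R -> R) (a df t : R) : t \in `]0, 1[ ->
  (forall s : R, s \in `]0, 1[ -> f s = a) -> is_derive t (1 : R) f df -> df = 0.
Proof.
move=> t01 fa [_ <-]; have [_ <-] := is_derive_cst a t (1 : R).
have o : open (`]0, 1[%classic : set R) by exact: interval_open.
by apply: near_eq_derive; exact: open_eq_near o t01 fa.
Qed.

Lemma unit_interval_oo_cc (t : R) : t \in `]0, 1[ -> t \in `[0, 1].
Proof. exact: subset_itv_oo_cc. Qed.

Lemma harmonic_uniqueness (g h dg dh : R -> R) (k a : R) : 0 <= k ->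
  (forall t : R, t \in `[0, 1] -> is_derive t (1 : R) g (dg t)) ->
  (forall t : R, t \in `[0, 1] -> is_derive t (1 : R) h (dh t)) ->
  (forall t : R, t \in `]0, 1[ -> dg t = h t - a) ->
  (forall t : R, t \in `]0, 1[ -> dh t = - k * g t) ->
  g 0 = 0 -> h 0 = a -> forall t : R, t \in `[0, 1] -> g t = 0.
Proof.
move=> k0 g_deriv h_deriv dgE dhE g0 h0.
(* k g^2 + (h - a)^2 is conserved. *)
have energy (t : R) : t \in `[0, 1] ->
    k * (g t * g t) + (h t - a) * (h t - a) = 0.
  move=> t01.
  pose u : R -> R := h + cst (- a).
  pose F : R -> R := k \*: (g * g) + u * u.
  pose dF s := k *: (g s *: dg s + g s *: dg s) +
    (u s *: (dh s + 0) + u s *: (dh s + 0)).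
  have F_deriv (s : R) : s \in `[0, 1] -> is_derive s (1 : R) F (dF s).
    move=> s01; have g' := g_deriv s s01.
    have u' := is_deriveD (h_deriv s s01) (is_derive_cst (- a) s 1).
    exact: (is_deriveD (is_deriveZ k (is_deriveM g' g')) (is_deriveM u' u')).
  have dF0 (s : R) : s \in `]0, 1[ -> dF s = 0.
    move=> s01; have uE : u s = h s - a by [].
    by rewrite /dF dgE // dhE // uE /GRing.scale /=; ring.
  have FE s : F s = k * (g s * g s) + (h s - a) * (h s - a) by [].
  rewrite -FE (eq_on_unit_interval F_deriv dF0 t01) FE g0 h0 subrr.
  by rewrite !mulr0 addr0.
have hE (t : R) : t \in `[0, 1] -> h t = a.
  move=> /energy /eqP; rewrite paddr_eq0; last 2 first.
  - by rewrite mulr_ge0 // -expr2 sqr_ge0.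
  - by rewrite -expr2 sqr_ge0.
  by case/andP => _; rewrite mulf_eq0 orbb subr_eq0 => /eqP.
(* When [k = 0] the energy does not control [g], so for every [k] the vanishing of [g] is deduced
   from [dg = h - a = 0]. *)
move=> t t01; rewrite -[RHS]g0; apply: eq_on_unit_interval g_deriv _ _ t01.
by move=> s s01; rewrite dgE // hE ?subrr //; exact: unit_interval_oo_cc.
Qed.

End Smoothness.

(** * Geodesics of the unit sphere and explicit transport along them *)

Section SphereGeodesic.
Context {R : realType} {n : nat} (nu dnu ddnu : R -> 'rV[R]_n).
Context (nu_deriv : forall t : R, t \in `[0, 1] -> is_derive t (1 : R) nu (dnu t))
  (dnu_deriv : forall t : R, t \in `[0, 1] -> is_derive t (1 : R) dnu (ddnu t))
  (nu_unit : forall t : R, t \in `[0, 1] -> dot (nu t) (nu t) = 1)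
  (ddnu_normal : forall t : R, t \in `[0, 1] ->
     ddnu t = dot (ddnu t) (nu t) *: nu t).

Let sqspeed : R := dot (dnu 0) (dnu 0).

Lemma velocity_tangent (t : R) : t \in `]0, 1[ -> dot (dnu t) (nu t) = 0.
Proof.
move=> t01; have d := nu_deriv (unit_interval_oo_cc t01).
have nu_unit' (s : R) : s \in `]0, 1[ -> dot (nu s) (nu s) = 1.
  by move=> /unit_interval_oo_cc /nu_unit.
have := derive_cst_on_unit_interval t01 nu_unit' (is_derive_dot d d).
by rewrite (dotC (nu t)) -mulr2n => /eqP; rewrite mulrn_eq0 => /eqP.
Qed.

(** The derivative is [2 * dot ddnu dnu], where [ddnu] is a multiple of [nu] and [nu] is orthogonal
    to [dnu]. *)
Lemma sqspeed_constant (t : R) : t \in `[0, 1] -> dot (dnu t) (dnu t) = sqspeed.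
Proof.
move=> t01; apply: (eq_on_unit_interval (f := fun t => dot (dnu t) (dnu t))) t01.
  by move=> s /dnu_deriv d; exact: (is_derive_dot d d).
move=> s s01 /=; rewrite ddnu_normal; last exact: unit_interval_oo_cc.
by rewrite dotZr dotZl (dotC (nu s)) velocity_tangent // mulr0 addr0.
Qed.

(** Differentiating [dot dnu nu = 0] gives [dot ddnu nu = - dot dnu dnu], which identifies the
    coefficient in [ddnu_normal]. *)
Lemma acceleration (t : R) : t \in `]0, 1[ -> ddnu t = - sqspeed *: nu t.
Proof.
move=> t01; have t01' := unit_interval_oo_cc t01.
rewrite ddnu_normal //; congr (_ *: _).
have := derive_cst_on_unit_interval t01 velocity_tangent
  (is_derive_dot (dnu_deriv t01') (nu_deriv t01')).
by rewrite sqspeed_constant // => /eqP; rewrite addr_eq0 => /eqP.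
Qed.

(* For a constant geodesic sqspeed = 0, and 1 / 0 = 0 yields the constant field. *)
Definition sphere_rate (x : 'rV[R]_n) : R := dot x (dnu 0) / sqspeed.

Definition sphere_transport (x : 'rV[R]_n) (t : R) : 'rV[R]_n :=
  (x - sphere_rate x *: dnu 0) + sphere_rate x *: dnu t.

(** If the speed is zero then [dnu 0 = 0] by definiteness, and both sides vanish; constant geodesics
    thus need no separate treatment later. *)
Lemma sphere_rateK x : sphere_rate x * sqspeed = dot x (dnu 0).
Proof.
have [s0|s0] := eqVneq sqspeed 0; last by rewrite /sphere_rate divfK.
by rewrite s0 mulr0 (dot_eq0 s0) dot0r.
Qed.

Lemma sphere_transport0 x : sphere_transport x 0 = x.
Proof. by rewrite /sphere_transport subrK. Qed.

Lemma sphere_transport_deriv x (t : R) : t \in `[0, 1] ->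
  is_derive t (1 : R) (sphere_transport x) (sphere_rate x *: ddnu t).
Proof. by move=> t01; apply: is_derive_affine; exact: dnu_deriv. Qed.

Lemma sphere_transport_tangent x (t : R) : dot x (nu 0) = 0 -> t \in `[0, 1] ->
  dot (sphere_transport x t) (nu t) = 0.
Proof.
move=> x0 t01.
have g_deriv (s : R) (s01 : s \in `[0, 1]) :=
  is_derive_dot (sphere_transport_deriv x s01) (nu_deriv s01).
have h_deriv (s : R) (s01 : s \in `[0, 1]) :=
  is_derive_dot (sphere_transport_deriv x s01) (dnu_deriv s01).
have sqspeed_ge0 : 0 <= sqspeed by apply: sumr_ge0 => i _; rewrite -expr2 sqr_ge0.
apply: (harmonic_uniqueness (a := dot x (dnu 0)) sqspeed_ge0 g_deriv h_deriv) t01.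
(* The term [rate * dot ddnu nu] equals [- rate * sqspeed], which is [- a] by [sphere_rateK]. *)
- move=> s s01; rewrite acceleration // !dotZl nu_unit ?unit_interval_oo_cc //.
  by rewrite mulr1 mulrN sphere_rateK addrC.
(* The field varies along [nu], orthogonally to [dnu], so only its product with
   [ddnu = - sqspeed *: nu] remains. *)
- move=> s s01; rewrite acceleration // !dotZl dotZr (dotC (nu s)).
  by rewrite velocity_tangent // !mulr0 add0r.
- by rewrite sphere_transport0.
- by rewrite sphere_transport0.
Qed.

Lemma sphere_transport_dot x y (t : R) : dot x (nu 0) = 0 -> dot y (nu 0) = 0 ->
  t \in `[0, 1] ->
  dot (sphere_transport x t) (sphere_transport y t) = dot x y.
Proof.
move=> x0 y0 t01.
rewrite -[in RHS](sphere_transport0 x) -[in RHS](sphere_transport0 y).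
apply: (eq_on_unit_interval
  (f := fun t => dot (sphere_transport x t) (sphere_transport y t))) t01.
  by move=> s s01; exact: (is_derive_dot (sphere_transport_deriv x s01)
    (sphere_transport_deriv y s01)).
move=> s s01 /=; have s01' := unit_interval_oo_cc s01.
rewrite acceleration // !(dotZl, dotZr) sphere_transport_tangent //.
by rewrite (dotC (nu s)) sphere_transport_tangent // !mulr0 addr0.
Qed.

End SphereGeodesic.

(** * Construction of the parallel frame along the Lorentzian geodesic *)

Theorem proposition6p4 (R : realType) (n : nat) (nu : R -> 'rV[R]_n)
    (c : R -> R) (e0 : 'I_n.-1 -> 'rV[R]_n)
    (gamma_geod : lorentzian_geodesic (fun t => eps_pair (nu t) (c t)))
    (e0_frame : orthonormal_frame (nu 0) e0) :
  exists (e : 'I_n.-1 -> R -> 'rV[R]_n) (beta : 'I_n.-1 -> R -> R),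
    [/\ (forall i, smooth_on `[0, 1] (e i)) /\
          (forall i, smooth_on `[0, 1] (beta i)),
        forall t, t \in `[0, 1] -> orthonormal_frame (nu t) (e^~ t),
        forall i, e i 0 = e0 i,
        forall i, lorentzian_parallel nu c (e i) (beta i) &
        forall t, t \in `[0, 1] -> forall i j,
          lform (eps_pair (e i t) (beta i t)) (eps_pair (e j t) (beta j t))
            = (i == j)%:R].
Proof.
have [[gamma_smooth gamma_Lambda gamma_acc] _] := gamma_geod.
have [nu_smooth c_smooth] := (smooth_on_eps_pair _ _ _).1 gamma_smooth.
have [U [oU sU dU]] := nu_smooth; have [W [oW sW dW]] := c_smooth.
pose dnu := derive1 nu; pose ddnu := derive1 dnu.
pose dc := derive1 c; pose ddc := derive1 dc.
have nu_deriv (t : R) : t \in `[0, 1] -> is_derive t (1 : R) nu (dnu t).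
  by rewrite /dnu derive1E => /sU Ut; apply: derivableP; exact: (dU 0%N).
have dnu_deriv (t : R) : t \in `[0, 1] -> is_derive t (1 : R) dnu (ddnu t).
  by rewrite /ddnu derive1E => /sU Ut; apply: derivableP; exact: (dU 1%N).
have dc_deriv (t : R) : t \in `[0, 1] -> is_derive t (1 : R) dc (ddc t).
  by rewrite /ddc derive1E => /sW Wt; apply: derivableP; exact: (dW 1%N).
have nu_unit t : t \in `[0, 1] -> dot (nu t) (nu t) = 1.
  by move=> /gamma_Lambda; rewrite /Lambda /= lform_eps_pair.
have ddgammaE t : t \in `[0, 1] ->
    derive1 (derive1 (fun t => eps_pair (nu t) (c t))) t =
    eps_pair (ddnu t) (ddc t).
  move=> t01; rewrite -derive1_eps_pair; last 2 first.
  - exact: (dU 1%N _ (sU _ t01)).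
  - exact: (dW 1%N _ (sW _ t01)).
  apply: (open_eq_derive1 (openI oU oW)); first by split; [exact: sU|exact: sW].
  move=> s [Us Ws]; rewrite derive1_eps_pair //; first exact: (dU 0%N).
  exact: (dW 0%N).
(* The form ignores the [epsilon] parts, so the same factor [dot ddnu nu] governs [nu] and [c]; the
   first component says that [nu] is a geodesic of the sphere. *)
have acc t : t \in `[0, 1] -> eps_pair (ddnu t) (ddc t) -
    dot (ddnu t) (nu t) *: eps_pair (nu t) (c t) = 0.
  by move=> t01; have := gamma_acc t t01; rewrite /covder ddgammaE // lform_eps_pair.
have ddnu_normal t : t \in `[0, 1] -> ddnu t = dot (ddnu t) (nu t) *: nu t.
  by move=> /acc/subr0_eq; rewrite -eps_pairZ => /eps_pair_inj.
(* Each [e0 i] lies in its own span, with Kronecker coefficients, hence in the hyperplane. *)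
have e0_tangent i : dot (e0 i) (nu 0) = 0.
  rewrite dotC; apply/(e0_frame.2 _).2; exists (fun j => (j == i)%:R).
  rewrite (bigD1 i) //= eqxx scale1r big1 ?addr0 // => j /negPf ->.
  by rewrite scale0r.
pose q i := sphere_rate dnu (e0 i).
pose e i := sphere_transport dnu (e0 i).
(* The rate [q i] is the one used in [e i], so the pair is a constant vector plus [q i] times the
   velocity of the geodesic; the constant is chosen to give [beta i 0 = 0]. *)
pose beta i t := - q i * dc 0 + q i *: dc t.
have e_smooth i : smooth_on `[0, 1] (e i) by exact: smooth_on_affine_derive1.
have beta_smooth i : smooth_on `[0, 1] (beta i).
  exact: smooth_on_affine_derive1.
have e_tangent i t : t \in `[0, 1] -> dot (e i t) (nu t) = 0.
  exact: (sphere_transport_tangent nu_deriv dnu_deriv nu_unit ddnu_normal).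
have e_dot i j t : t \in `[0, 1] -> dot (e i t) (e j t) = (i == j)%:R.
  move=> t01; rewrite -e0_frame.1.
  exact: (sphere_transport_dot nu_deriv dnu_deriv nu_unit ddnu_normal).
exists e, beta; split; first by split.
- move=> t t01; apply: orthonormal_span => [|i|i j]; first exact: nu_unit.
    by rewrite dotC e_tangent.
  exact: e_dot.
- by move=> i; exact: sphere_transport0.
- move=> i; split=> [t|]; first exact: e_tangent.
  split=> [|t t01|t t01].
    exact: (smooth_on_eps_pair _ _ _).2 (conj (e_smooth i) (beta_smooth i)).
    by rewrite lform_eps_pair e_tangent.
  have e_deriv := sphere_transport_deriv dnu_deriv (e0 i) t01.
  have beta_deriv := is_derive_affine (- q i * dc 0) (q i) (dc_deriv t t01).
  have [_ X'] := is_derive_eps_pair e_deriv beta_deriv.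
  (* The derivative of the field is [q i] times the acceleration of the geodesic, so its covariant
     derivative is [q i] times the left side of [acc]. *)
  rewrite /covder derive1E X' eps_pairZ lformZl lform_eps_pair -scalerA -scalerBr.
  by rewrite acc // scaler0.
- by move=> t t01 i j; rewrite lform_eps_pair e_dot.
Qed.
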